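(* Let $G$ be a finite bipartite graph with bipartition $(L,R)$, let $s,d$ be integers and let $\epsilon < \frac{1}{23}$ be a positive real number. Suppose each vertex in $L$ has degree exactly $3$, each vertex in $R$ has degree at most $d$, and $G$ is an $(s, 2-\frac{\epsilon}{2})$-expander. Then Coverer wins the cover game $\mathsf{CoverGame}(G,\mu)$ with $\mu = \frac{\epsilon s}{72 d + 2\epsilon} - d$.
   Context: A $(2,4)$-matching in a bipartite graph $G$ with bipartition $(L,R)$ is a subgraph $F$ of $G$ such that each connected component of $F$ is a tree with at most $4$ edges and each vertex of $V(F)\cap L$ has degree exactly $2$ in $F$; $F$ covers a vertex $v$ if $v \in V(F)$. A bipartite graph $G$ with bipartition $(L,R)$ is an $(s,\delta)$-expander if every $X \subseteq L$ with $|X| \le s$ satisfies $|N_G(X)| \geq \delta |X|$. The cover game $\mathsf{CoverGame}(G,\mu)$ is played between two players, Chooser and Coverer, who maintain a $(2,4)$-matching $F_i$ in $G$ (initially empty). At step $i+1$ Chooser may either (1) remove a connected component from $F_i$, or (2) if $F_i$ has strictly fewer than $\mu$ connected components, pick a vertex of $G$ and challenge Coverer to find a $(2,4)$-matching $F_{i+1}$ in $G$ such that every connected component of $F_i$ is also a connected component of $F_{i+1}$, and $F_{i+1}$ covers the picked vertex. Coverer loses if at some point she cannot answer a challenge; otherwise Coverer wins. ''Coverer wins'' means Coverer has a strategy that answers every challenge in every play of the game. *)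

(* Defs.v *)
From HB Require Import structures.
From mathcomp Require Import all_boot all_order all_algebra.
From mathcomp Require Import reals.

Set Implicit Arguments.
Unset Strict Implicit.
Unset Printing Implicit Defensive.

Import Order.TTheory GRing.Theory Num.Theory.
Local Open Scope ring_scope.

Section Graphs.
Variable V : finType.

Definition simple_graph (G : rel V) : Prop := symmetric G /\ irreflexive G.

Definition bipartition (G : rel V) (L R : {set V}) : Prop :=
  [/\ L :|: R = [set: V], [disjoint L & R] &
      forall x y, G x y ->
        (x \in L /\ y \in R) \/ (x \in R /\ y \in L)].

Definition deg (G : rel V) (x : V) : nat := #|[set y | G x y]|.

Definition nbh (G : rel V) (X : {set V}) : {set V} :=
  [set y | [exists x in X, G x y]].

Definition expander (K : realType) (G : rel V) (L : {set V})
    (s : int) (delta : K) : Prop :=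
  forall X : {set V}, X \subset L -> #|X|%:Z <= s ->
    delta * #|X|%:R <= #|nbh G X|%:R.

(* A (candidate) subgraph is a vertex set together with a set of edges, each
   edge being the two-element set of its ends.  Well-formedness is the separate
   predicate [is_subgraph].  Vertices isolated in a subgraph are allowed. *)
Definition sub : Type := ({set V} * {set {set V}})%type.
Definition verts (F : sub) : {set V} := F.1.
Definition edges (F : sub) : {set {set V}} := F.2.
Definition empty_sub : sub := (set0, set0).

Definition is_subgraph (G : rel V) (F : sub) : Prop :=
  forall a, a \in edges F ->
    exists x y, [/\ x \in verts F, y \in verts F, G x y & a = [set x; y]].

Definition adj (F : sub) : rel V :=
  [rel x y | (x != y) && ([set x; y] \in edges F)].

Definition connected_sub (F : sub) : Prop :=
  verts F != set0 /\ {in verts F &, forall x y, connect (adj F) x y}.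

Definition acyclic_sub (F : sub) : Prop :=
  forall c : seq V, (2 < size c)%N -> ~ ucycle (adj F) c.

Definition is_tree (F : sub) : Prop := connected_sub F /\ acyclic_sub F.

(* Components are themselves subgraphs: two components with the same vertices
   but different edges are different. *)
Definition component (F : sub) (x : V) : sub :=
  let C := [set y in verts F | connect (adj F) x y] in
  (C, [set a in edges F | a \subset C]).

Definition components (F : sub) : {set sub} :=
  [set component F x | x in verts F].

Definition remove_component (F C : sub) : sub :=
  (verts F :\: verts C, edges F :\: edges C).

Definition matching24 (G : rel V) (L : {set V}) (F : sub) : Prop :=
  [/\ is_subgraph G F,
      forall C, C \in components F -> is_tree C /\ (#|edges C| <= 4)%N &
      forall x, x \in verts F :&: L -> deg (adj F) x = 2%N].

End Graphs.

Section CoverGame.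
Variables (K : realType) (V : finType) (G : rel V) (L : {set V}) (mu : K).

Inductive chooser_move : Type :=
  | Remove of sub V
  | Challenge of V.

(* A history lists Chooser's moves, each paired with the position reached after
   it (and after Coverer's answer, for a challenge), most recent first. *)
Definition history : Type := seq (chooser_move * sub V).

Definition position (h : history) : sub V :=
  if h is (_, F) :: _ then F else empty_sub V.

Definition may_challenge (F : sub V) : Prop := #|components F|%:R < mu.

Definition answers (F : sub V) (v : V) (F' : sub V) : Prop :=
  [/\ matching24 G L F', components F \subset components F' & v \in verts F'].

Definition strategy : Type := history -> V -> sub V.

Inductive consistent (sigma : strategy) : history -> Prop :=
  | Consistent_start : consistent sigma [::]
  | Consistent_remove h C :
      consistent sigma h -> C \in components (position h) ->
      consistent sigma ((Remove C, remove_component (position h) C) :: h)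
  | Consistent_challenge h v :
      consistent sigma h -> may_challenge (position h) ->
      consistent sigma ((Challenge v, sigma h v) :: h).

(* Every challenge occurs after a finite history, so quantifying over finite
   consistent histories also accounts for infinite plays. *)
Definition coverer_wins : Prop :=
  exists sigma : strategy, forall h v,
    consistent sigma h -> may_challenge (position h) ->
    answers (position h) v (sigma h v).

End CoverGame.

(* Main.v *)
(** Coverer may keep the invariant that every set of at most [s] left vertices
    can still be covered by a (2,4)-matching having the current components among
    its own; it survives the removal of components.

    Such matchings exist under expansion by 11/6: Hall's theorem distributes 11
    units over the edges at each left vertex so that no right vertex receives
    more than 6, and dropping the lightest of the three edges at each left vertex
    leaves a (2,4)-matching.  Hence, when [S] is the set of covered right
    vertices, an uncoverable set contains one with at most [7 * #|S|] elements.

    To answer a challenge at a left vertex, consider the linearly many components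
    that could contain it.  If each violated the invariant, the union of their
    small obstructions, together with the vertex, could be covered by the
    invariant, and the component of the vertex would contradict its obstruction.
    For a right vertex, Coverer first covers all of its neighbours; if it is
    still uncovered, it can safely be added as an isolated vertex. *)
Require Import Defs.
From mathcomp Require Import all_boot all_order all_algebra.
From mathcomp Require Import reals.
From mathcomp Require Import boolp zify lra.
Import Order.TTheory GRing.Theory Num.Theory.
Local Open Scope ring_scope.
Set Implicit Arguments.
Unset Strict Implicit.
Unset Printing Implicit Defensive.
Local Open Scope nat_scope.

(** * Hall's theorem *)

Section Marriage.
Variables (A B : finType) (b0 : B) (D : {set A}).
Implicit Types (e : A -> {set B}) (X : {set A}).

Definition hall_condition e :=
  forall X, X \subset D -> #|X| <= #|\bigcup_(x in X) e x|.

Definition delete e x y := fun x' => if x' == x then e x :\ y else e x'.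

(** A set that misses [x] keeps its union under the deletion, so only sets containing [x] can become
    violators. *)
Lemma drop_violation e x y :
  hall_condition e -> ~ hall_condition (delete e x y) ->
  exists X, [/\ X \subset D, x \in X & #|\bigcup_(x' in X) delete e x y x'| < #|X|].
Proof.
move=> hall /existsNP[X /not_implyP[sXD]]; rewrite leqNgt => /negP.
rewrite negbK => ltX; exists X; split=> //; apply: contraLR ltX => xX.
rewrite -leqNgt (leq_trans (hall X sXD)) // eq_leq //; congr #|pred_of_set _|.
by apply: eq_bigr => x' x'X; rewrite /delete ifN //; apply: contraNneq xX => <-.
Qed.

(* Two violators [X], [Y] for the two deletions would, by submodularity of
   [X |-> #|\bigcup_(x in X) e x|], contradict the condition for [X :|: Y] and
   [X :&: Y :\ x]. *)
Lemma hall_drop e x y z :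
  hall_condition e -> y \in e x -> z \in e x -> y != z ->
  hall_condition (delete e x y) \/ hall_condition (delete e x z).
Proof.
move=> hall yx zx yz; apply: contrapT => /not_orP[].
move=> /(drop_violation hall)[X [sX xX ltX]] /(drop_violation hall)[Y [sY xY ltY]].
have sU : \bigcup_(x' in X :|: Y) e x' \subset
    (\bigcup_(x' in X) delete e x y x') :|: (\bigcup_(x' in Y) delete e x z x').
  apply/bigcupsP=> x' x'XY; apply/subsetP=> w wx'.
  have [x'x|x'x] := eqVneq x' x.
    rewrite x'x in wx'; have [wy|wy] := eqVneq w y.
      apply/setUP; right; apply/bigcupP; exists x => //.
      by rewrite /delete eqxx !inE wy yz -wy.
    by apply/setUP; left; apply/bigcupP; exists x; rewrite // /delete eqxx !inE wy.
  case/setUP: x'XY => x'X; apply/setUP; [left|right]; apply/bigcupP; exists x' => //;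
    by rewrite /delete (negPf x'x).
have sI : \bigcup_(x' in (X :&: Y) :\ x) e x' \subset
    (\bigcup_(x' in X) delete e x y x') :&: (\bigcup_(x' in Y) delete e x z x').
  apply/bigcupsP=> x'; rewrite !inE => /and3P[x'x x'X x'Y]; apply/subsetP=> w wx'.
  by apply/setIP; split; apply/bigcupP; exists x'; rewrite // /delete (negPf x'x).
have hU : #|X :|: Y| <= #|_| := leq_trans (hall _ _) (subset_leq_card sU).
have hI : #|(X :&: Y) :\ x| <= #|_| := leq_trans (hall _ _) (subset_leq_card sI).
have {}hU := hU ltac:(by rewrite subUset sX).
have {}hI := hI ltac:(by apply: subset_trans sX; rewrite subDset subsetU // subsetIl orbT).
have := cardsUI X Y; have := cardsD1 x (X :&: Y); rewrite inE xX xY /=.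
have := cardsUI (\bigcup_(x' in X) delete e x y x') (\bigcup_(x' in Y) delete e x z x').
move: hU hI ltX ltY; lia.
Qed.

(** Rado's argument: by induction on the total size of the candidate sets, candidates are deleted,
    preserving the condition, until every set is a singleton; the condition on pairs then makes the
    choice injective. *)
Theorem marriage e : hall_condition e ->
  exists2 f : A -> B, {in D, forall x, f x \in e x} & {in D &, injective f}.
Proof.
have [n] := ubnP (\sum_(x in D) #|e x|); elim: n e => // n IHn e ltn hall.
have [[x xD /card_gt1P[y [z [yx zx yz]]]]|small] :=
    pselect (exists2 x, x \in D & 1 < #|e x|).
  have IH w : w \in e x -> hall_condition (delete e x w) ->
      exists2 f : A -> B, {in D, forall x, f x \in e x} & {in D &, injective f}.
    move=> wx hallw; case: (IHn (delete e x w)) => // [|f fe finj].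
      move: ltn; rewrite ltnS; apply: leq_trans.
      rewrite (bigD1 x) //= [X in _ < X](bigD1 x) //=.
      rewrite -addSn leq_add //; first by rewrite /delete eqxx [X in _ < X](cardsD1 w) wx.
      by apply: leq_sum => x' /andP[_ x'x]; rewrite /delete (negPf x'x).
    exists f => // x' x'D; have := fe _ x'D; rewrite /delete.
    by case: eqP => // -> /setD1P[].
  by case: (hall_drop hall yx zx yz); apply: IH.
have e1 x : x \in D -> #|e x| = 1.
  move=> xD; apply/eqP; rewrite eqn_leq leqNgt.
  apply/andP; split; first by apply/negP => xe; apply: small; exists x.
  by have := hall [set x]; rewrite sub1set big_set1 cards1; apply.
exists (fun x => odflt b0 [pick y in e x]) => [x xD|x x' xD x'D].
  by case: pickP => [y //|e0]; have := e1 _ xD; rewrite eq_card0.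
have := e1 _ xD => /eqP/cards1P[y ex]; have := e1 _ x'D => /eqP/cards1P[y' ex'].
case: pickP => [w|/(_ y)]; last by rewrite ex inE eqxx.
case: pickP => [w'|/(_ y')]; last by rewrite ex' inE eqxx.
rewrite ex ex' !inE => /eqP-> /eqP-> /= eyy; apply: contraTeq isT => xx'.
have := hall [set x; x']; rewrite cards2 xx' subUset !sub1set xD x'D.
by rewrite big_setU1 ?inE // big_set1 ex ex' eyy /= setUid cards1 => /(_ isT).
Qed.

End Marriage.

(** * Components of subgraphs *)

Lemma next_next_neq (T : eqType) (c : seq T) x :
  uniq c -> 2 < size c -> x \in c -> next c (next c x) != x.
Proof.
move=> uc c2 /rot_to[i p rc]; rewrite -!(next_rot i uc).
move: uc c2; rewrite -(rot_uniq i) -(size_rot i) rc.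
case: p {rc} => [|y [|z p]] //= /and3P[xN yN _] _; rewrite !inE !negb_or in xN yN.
by case/and3P: xN => xy xz _; rewrite eqxx (eq_sym y) (negPf xy) eqxx eq_sym.
Qed.

Lemma set2_inj (T : finType) (x y l r : T) :
  x != y -> [set x; y] = [set l; r] -> (x = l /\ y = r) \/ (x = r /\ y = l).
Proof.
move=> + e; have : x \in [set l; r] by rewrite -e set21.
have : y \in [set l; r] by rewrite -e set22.
by case/set2P=> -> /set2P[] ->; rewrite ?eqxx // => _; [right|left].
Qed.

Section Components.
Variables (V : finType) (G : rel V).
Implicit Types (F : sub V) (x y : V).

Lemma adj_sym F : symmetric (adj F).
Proof. by move=> x y; rewrite /adj /= eq_sym setUC. Qed.

Lemma adj_verts F x y : is_subgraph G F -> adj F x y -> x \in verts F /\ y \in verts F.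
Proof.
move=> sF /andP[xy /sF[u [v [uF vF _ e]]]].
by case: (set2_inj xy e) => -[-> ->].
Qed.

Lemma path_closed (e : rel V) (D : {pred V}) x p :
  (forall y z, y \in D -> e y z -> z \in D) -> x \in D -> path e x p ->
  path [rel y z | [&& y \in D, z \in D & e y z]] x p.
Proof.
move=> cl; elim: p x => //= y p IH x xD /andP[exy ep].
by rewrite xD exy (cl x y) //= IH // (cl x y).
Qed.

Lemma connect_closed (e : rel V) (D : {pred V}) x y :
  (forall y z, y \in D -> e y z -> z \in D) -> x \in D -> connect e x y ->
  connect [rel y z | [&& y \in D, z \in D & e y z]] x y /\ y \in D.
Proof.
move=> cl xD /connectP[p ep ->].
have ep' := path_closed cl xD ep; split; first by apply/connectP; exists p.
elim: p x xD {ep} ep' => //= z p IH x _ /andP[/and3P[_ zD _]]; exact: IH.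
Qed.

Lemma component_closed F x y z : is_subgraph G F ->
  adj F y z -> (y \in verts (component F x)) = (z \in verts (component F x)).
Proof.
move=> sF yz; have [yF zF] := adj_verts sF yz; rewrite !inE yF zF /=.
by apply: same_connect_r; [apply/sym_connect_sym/adj_sym | apply: connect1].
Qed.

Lemma component_refl F x : x \in verts F -> x \in verts (component F x).
Proof. by move=> xF; rewrite inE xF connect0. Qed.

Lemma component_connected F x :
  is_subgraph G F -> x \in verts F -> connected_sub (component F x).
Proof.
move=> sF xF; have symF := sym_connect_sym (adj_sym F); split.
  by apply/set0Pn; exists x; apply: component_refl.
move=> y z yC; have := yC; rewrite !inE => /andP[_ xy] /andP[_ xz].
have yz : connect (adj F) y z by rewrite (same_connect symF xy) // in xz.
have cl u v : u \in verts (component F x) -> adj F u v -> v \in verts (component F x).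
  by move=> uC uv; rewrite -(component_closed x sF uv).
have [+ _] := connect_closed cl yC yz; apply: connect_sub => u v /=.
case/and3P=> uC vC /andP[uv uvF]; apply: connect1; rewrite /adj /= uv inE uvF.
by rewrite subUset !sub1set uC vC.
Qed.

Lemma acyclic_subset F F' :
  edges F \subset edges F' -> acyclic_sub F' -> acyclic_sub F.
Proof.
move=> /subsetP sE acF' c c2 /andP[cc uc]; apply: (acF' c c2); rewrite /ucycle uc andbT.
by apply: sub_cycle cc => x y /andP[xy /sE]; rewrite /adj /= xy.
Qed.

End Components.

(** * Matchings from expansion *)

Section Selections.
Variables (V : finType) (G : rel V) (L R : {set V}).
Implicit Types (X Y Z A S T : {set V}) (nb : V -> {set V}).

Local Notation N x := [set y | G x y].

(** Hall's theorem is applied to 11 copies of each left vertex and 6 copies of each right vertex;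
    [w l r] counts the copies of [l] matched to copies of [r]. *)
Lemma fractional_assignment X A :
  (forall Y, Y \subset X -> 11 * #|Y| <= 6 * #|nbh G Y :\: A|) ->
  exists w : V -> V -> nat,
    [/\ {in X, forall l r, r \notin N l :\: A -> w l r = 0},
        {in X, forall l, \sum_r w l r = 11} &
        forall r, \sum_(l in X) w l r <= 6].
Proof.
(* A nonempty [X] supplies the default value that [marriage] asks for. *)
move=> hall; have [->|[x0 _]] := set_0Vmem X.
  by exists (fun _ _ => 0); split=> [x|x|r]; rewrite ?inE // big_set0.
pose e (p : V * 'I_11) := setX (N p.1 :\: A) [set: 'I_6].
have [|f fe finj] := @marriage _ _ (x0, ord0) (setX X [set: 'I_11]) e.
  move=> Z sZ; have sY : fst @: Z \subset X.
    by apply/subsetP=> l /imsetP[p /(subsetP sZ)]; rewrite inE => /andP[pX _] ->.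
  have leZ : #|Z| <= 11 * #|fst @: Z|.
    have <- : #|setX (fst @: Z) [set: 'I_11]| = 11 * #|fst @: Z|.
      by rewrite cardsX cardsT card_ord mulnC.
    apply/subset_leq_card/subsetP.
    by move=> p pZ; rewrite !inE andbT imset_f.
  apply: leq_trans leZ (leq_trans (hall _ sY) _).
  have <- : #|setX (nbh G (fst @: Z) :\: A) [set: 'I_6]| = 6 * #|nbh G (fst @: Z) :\: A|.
    by rewrite cardsX cardsT card_ord mulnC.
  apply/subset_leq_card/subsetP.
  move=> [r j]; rewrite !inE andbT /= => /andP[rA /existsP[l /andP[/imsetP[p pZ ->] Gr]]].
  by apply/bigcupP; exists p; rewrite ?inE ?rA ?Gr.
exists (fun l r => #|[set i | (f (l, i)).1 == r]|); split=> [l lX r rN|l lX|r].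
- apply: eq_card0 => i; rewrite inE; apply: contraNF rN => /eqP <-.
  by have := fe (l, i) ltac:(by rewrite !inE lX); rewrite inE => /andP[].
- rewrite -[RHS]card_ord -sum1_card (partition_big (fun i => (f (l, i)).1) xpredT) //=.
  by apply: eq_bigr => r _; rewrite -sum1_card; apply: eq_bigl => i; rewrite inE.
pose P := [set p | (p.1 \in X) && ((f p).1 == r)].
have -> : \sum_(l in X) #|[set i | (f (l, i)).1 == r]| = #|P|.
  rewrite -sum1_card; under eq_bigr do rewrite -sum1_card.
  by rewrite pair_big_dep; apply: eq_bigl => -[l i]; rewrite !inE.
rewrite -(@card_in_imset _ _ (fun p => (f p).2) P).
  by apply: leq_trans (max_card _) _; rewrite card_ord.
move=> p q; rewrite !inE => /andP[pX /eqP pr] /andP[qX /eqP qr] e2.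
apply: finj; rewrite ?inE ?pX ?qX //.
by rewrite (surjective_pairing (f p)) (surjective_pairing (f q)) pr qr e2.
Qed.

(** The heaviest weight is at most 6, so the others sum to at least 5 and the second is at least 3;
    the lightest of three is at most 11/3, hence at most 3, which leaves at least 8. *)
Lemma two_heaviest (w : V -> nat) (B : {set V}) :
  #|B| <= 3 -> {in B, forall r, w r <= 6} -> \sum_(r in B) w r = 11 ->
  exists p q, [/\ p \in B, q \in B, p != q, 3 <= w q & (w q <= w p) && (8 <= w p + w q)].
Proof.
move=> B3 w6 sumB; have [B0|[p0 p0B]] := set_0Vmem B; first by rewrite B0 big_set0 in sumB.
have [p pB0 pmax] := @arg_maxnP _ p0 (mem B) w p0B; have pB : p \in B := pB0.
have /= sumBp := @big_setD1 _ 0 addn _ p B w pB.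
have [Bp0|[q0 q0B]] := set_0Vmem (B :\ p).
  by move: (w6 _ pB); rewrite sumB Bp0 big_set0 in sumBp; lia.
have [q qB1 qmax] := @arg_maxnP _ q0 (mem (B :\ p)) w q0B; have qB : q \in B :\ p := qB1.
have /= sumBq := @big_setD1 _ 0 addn _ q (B :\ p) w qB.
have [qp qB0] := setD1P qB.
have rest : \sum_(r in (B :\ p) :\ q) w r <= w q.
  apply: leq_trans (_ : \sum_(r in (B :\ p) :\ q) w q <= _).
    by apply: leq_sum => r /setD1P[_ rB]; apply: qmax.
  rewrite sum_nat_const; suff le1 : #|(B :\ p) :\ q| <= 1.
    by rewrite -{2}[w q]mul1n leq_mul2r le1 orbT.
  by move: B3; rewrite (cardsD1 p B) (cardsD1 q (B :\ p)) pB qB /=; lia.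
exists p, q; split; rewrite // 1?eq_sym //.
  move: (w6 _ pB) (pmax _ qB0) => /=; lia.
move: (w6 _ pB) (pmax _ qB0) => /=; lia.
Qed.

(** [nb l] holds the right ends of the edges kept at [l]. The last clause lets [l] meet at most one
    other left vertex, and in one right vertex only (the case [l1 = l2]), so the kept edges form
    paths with 2 or 4 edges. *)
Definition selection X nb : Prop :=
  [/\ X \subset L,
      {in X, forall l, nb l \subset N l},
      {in X, forall l, #|nb l| = 2} &
      {in X & &, forall l l1 l2 r1 r2, l1 != l -> l2 != l ->
        r1 \in nb l :&: nb l1 -> r2 \in nb l :&: nb l2 -> l1 = l2 /\ r1 = r2}].

(* Every left vertex drops its lightest edge.  An edge that is kept weighs at
   least 3, so a right vertex keeps at most two, and two only if both weigh 3;
   the other kept edge of such a left vertex then weighs at least 5. *)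
Lemma selection_exists X A :
  X \subset L -> {in X, forall l, deg G l <= 3} ->
  (forall Y, Y \subset X -> 11 * #|Y| <= 6 * #|nbh G Y :\: A|) ->
  exists2 nb, selection X nb & {in X, forall l, [disjoint nb l & A]}.
Proof.
move=> sXL deg3 /fractional_assignment[w [w0 w11 w6]].
have w_le6 l r : l \in X -> w l r <= 6.
  by move=> lX; apply: leq_trans (w6 r); rewrite (bigD1 l) //= leq_addr.
have w2 l l' r : l \in X -> l' \in X -> l' != l -> w l r + w l' r <= 6.
  move=> lX l'X l'l; apply: leq_trans (w6 r).
  by rewrite (bigD1 l) //= (bigD1 l') ?l'X //= addnA leq_addr.
have w3 l l1 l2 r : l \in X -> l1 \in X -> l2 \in X -> l1 != l -> l2 != l ->
    l1 != l2 -> w l r + w l1 r + w l2 r <= 6.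
  move=> lX l1X l2X l1l l2l l12; apply: leq_trans (w6 r).
  rewrite (bigD1 l) //= (bigD1 l1) ?l1X //= (bigD1 l2) /= ?l2X ?l2l 1?eq_sym //.
  by rewrite !addnA leq_addr.
have heavy l : exists pq : V * V, l \in X ->
    [/\ pq.1 \in N l :\: A, pq.2 \in N l :\: A, pq.1 != pq.2, 3 <= w l pq.2 &
        (w l pq.2 <= w l pq.1) && (8 <= w l pq.1 + w l pq.2)].
  have [lX|] := boolP (l \in X); last by exists (l, l).
  have [|r _||p [q H]] := @two_heaviest (w l) (N l :\: A).
  - by apply: leq_trans (deg3 _ lX); rewrite subset_leq_card // subsetDl.
  - exact: w_le6.
  - by rewrite -(w11 l lX) big_mkcond; apply: eq_bigr => r _; case: ifPn => // /(w0 _ lX).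
  by exists (p, q).
have [pq pqP] := choice heavy.
pose nb l := [set (pq l).1; (pq l).2]; exists nb; last first.
  move=> l /pqP[+ + _ _ _]; rewrite !inE => /andP[pA _] /andP[qA _].
  by rewrite disjoint_sym disjoints_subset; apply/subsetP=> x xA; rewrite !inE negb_or;
     apply/andP; split; [apply: contraNneq pA|apply: contraNneq qA] => <-.
have w_ge3 l r : l \in X -> r \in nb l -> 3 <= w l r.
  by move=> lX; have [_ _ _ q3 /andP[qp _]] := pqP l lX; case/set2P=> ->; lia.
have shared l l' r : l \in X -> l' \in X -> l' != l -> r \in nb l :&: nb l' ->
    w l r = 3 /\ r = (pq l).2.
  move=> lX l'X l'l /setIP[rl rl'].
  have := w2 _ _ r lX l'X l'l; have := w_ge3 _ _ lX rl; have := w_ge3 _ _ l'X rl'.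
  have [_ _ _ q3 /andP[qp pq8]] := pqP l lX.
  by case/set2P: rl => ->; split=> //; lia.
split=> // [l lX|l lX|l l1 l2 lX l1X l2X r1 r2 l1l l2l r1I r2I].
- have [p q _ _ _] := pqP l lX; apply/subsetP=> r /set2P[] ->; [move: p|move: q];
    by rewrite !inE => /andP[].
- by have [_ _ ne _ _] := pqP l lX; rewrite cards2 ne.
have [wr1 e1] := shared _ _ _ lX l1X l1l r1I; have [wr2 e2] := shared _ _ _ lX l2X l2l r2I.
split; last by rewrite e1 e2.
apply: contrapT => /eqP l12; have := w3 _ _ _ r1 lX l1X l2X l1l l2l l12.
move: r1I r2I; rewrite -e1 in e2; rewrite e2 => /setIP[_ r1l1] /setIP[_ r1l2].
have := w_ge3 _ _ l1X r1l1; have := w_ge3 _ _ l2X r1l2; lia.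
Qed.

(** * Safe positions *)

Lemma sub_selection X Y nb : selection X nb -> Y \subset X -> selection Y nb.
Proof.
move=> [sXL sN c2 share] /subsetP sYX; split.
- by apply: subset_trans sXL; apply/subsetP.
- by move=> l /sYX; apply: sN.
- by move=> l /sYX; apply: c2.
by move=> l l1 l2 /sYX lX /sYX l1X /sYX l2X; apply: share.
Qed.

Lemma eq_selection X nb nb' : {in X, nb =1 nb'} -> selection X nb -> selection X nb'.
Proof.
move=> e [sXL sN c2 share]; split=> // [l lX|l lX|l l1 l2 lX l1X l2X r1 r2].
- by rewrite -e ?sN.
- by rewrite -e ?c2.
by rewrite -!e //; apply: share.
Qed.

Lemma union_selection X Y nb :
  selection X nb -> selection Y nb ->
  {in X & Y, forall x y, [disjoint nb x & nb y]} -> selection (X :|: Y) nb.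
Proof.
move=> selX selY dis; have [sXL sNX cX shX] := selX; have [sYL sNY cY shY] := selY.
have cross x y r : r \in nb x :&: nb y -> x \in X -> y \in Y -> false.
  by move=> /setIP[rx ry] xX yY; rewrite (disjointFr (dis _ _ xX yY) rx) in ry.
split.
- by rewrite subUset sXL.
- by move=> l /setUP[]; [apply: sNX|apply: sNY].
- by move=> l /setUP[]; [apply: cX|apply: cY].
move=> l l1 l2 lXY l1XY l2XY r1 r2 ne1 ne2 I1 I2.
have I1' : r1 \in nb l1 :&: nb l by rewrite setIC.
have I2' : r2 \in nb l2 :&: nb l by rewrite setIC.
case/setUP: lXY => lM; case/setUP: l1XY => l1M; case/setUP: l2XY => l2M;
  solve [exact: (shX l) | exact: (shY l) | by have := cross _ _ _ I1 lM l1M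
    | by have := cross _ _ _ I2 lM l2M | by have := cross _ _ _ I1' l1M lM
    | by have := cross _ _ _ I2' l2M lM].
Qed.

(* A position of the game is described by the set [X] of covered left vertices,
   the two right vertices [nb l] joined to each [l] in [X], and the set [S] of
   all covered right vertices. *)
Definition legal X nb S : Prop :=
  [/\ selection X nb, {in X, forall l, nb l \subset S} & S \subset R].

(** New left vertices avoid all of [S], isolated right vertices included, so that every old
    component survives unchanged. *)
Definition extends X nb S X' nb' S' : Prop :=
  [/\ X \subset X', S \subset S', {in X, nb' =1 nb} &
      {in X' :\: X, forall l, [disjoint nb' l & S]}].

(** The final right set is taken to be [setT], so an extension amounts to its left vertices and
    their edges. *)
Definition extendable X nb S T : Prop :=
  exists X' nb', [/\ selection X' nb', extends X nb S X' nb' setT & T \subset X'].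

Variable s : nat.

Definition safe X nb S : Prop :=
  legal X nb S /\ forall T, T \subset L -> #|T| <= s -> extendable X nb S T.

Lemma extends_trans X nb S X1 nb1 S1 X2 nb2 S2 :
  extends X nb S X1 nb1 S1 -> extends X1 nb1 S1 X2 nb2 S2 ->
  extends X nb S X2 nb2 S2.
Proof.
move=> [sX sS e d] [sX1 sS1 e1 d1]; split.
- exact: subset_trans sX1.
- exact: subset_trans sS1.
- by move=> l lX; rewrite e1 ?e // (subsetP sX).
move=> l /setDP[lX2 lX]; have [lX1|lX1] := boolP (l \in X1).
  by rewrite e1 // d // inE lX.
by apply: disjointWr sS _; apply: d1; rewrite inE lX1.
Qed.

Lemma extends_refl X nb S : extends X nb S X nb S.
Proof. by split=> // l; rewrite setDv inE. Qed.

Hypothesis G_bip : bipartition G L R.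
Hypothesis degL : {in L, forall x, deg G x = 3}.
(** The ratio 91/46 is 2 - eps/2 at eps = 1/23, a lower bound for all smaller eps that keeps the
    counting in natural numbers. *)
Hypothesis expands : forall X, X \subset L -> #|X| <= s -> 91 * #|X| <= 46 * #|nbh G X|.

Lemma nbhU X Y : nbh G (X :|: Y) = nbh G X :|: nbh G Y.
Proof.
apply/setP=> y; rewrite !inE; apply/existsP/orP=> [[x]|].
  by rewrite inE => /andP[/orP[] xX Gxy]; [left|right]; apply/existsP; exists x; rewrite xX.
by case=> /existsP[x /andP[xX Gxy]]; exists x; rewrite inE xX ?orbT.
Qed.

Lemma sub_nbh X x : x \in X -> N x \subset nbh G X.
Proof.
by move=> xX; apply/subsetP=> y; rewrite !inE => Gxy; apply/existsP; exists x; rewrite xX.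
Qed.

(* [Y] is a maximal set violating the expansion by 11/6 outside [S]; what is
   left of [T] then expands by 11/6 outside [S] and the neighbourhood of [Y]. *)
Lemma small_obstruction X nb S T :
  legal X nb S -> T \subset L -> #|T| <= s ->
  (forall T', T' \subset T -> #|T'| <= 7 * #|S| -> extendable X nb S T') ->
  extendable X nb S T.
Proof.
move=> [selX nbS SR] sTL cT small.
pose viol Y := (Y \subset T :\: X) && (6 * #|nbh G Y :\: S| <= 11 * #|Y|).
have [|Y /maxsetP[/andP[sY vY] Ymax] _] := @maxset_exists _ viol set0.
  rewrite /viol sub0set (_ : nbh G set0 = set0) ?set0D ?cards0 //.
  by apply/setP=> y; rewrite !inE; apply/existsP=> -[x]; rewrite inE.
have sYT : Y \subset T by apply: subset_trans sY (subsetDl _ _).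
have [X1 [nb1 [sel1 [sX1 _ e1 d1] sYX1]]] : extendable X nb S Y.
  (* Violation gives 6 (|N(Y)| - |S|) <= 11 |Y|; with 91 |Y| <= 46 |N(Y)| this yields 40 |Y| <= 276
     |S|, hence |Y| <= 7 |S|. *)
  apply: small => //; have cYT := subset_leq_card sYT.
  have := expands (subset_trans sYT sTL) (leq_trans cYT cT).
  have := cardsID S (nbh G Y); have := subset_leq_card (subsetIr (nbh G Y) S).
  by move: vY; lia.
pose Z := (T :\: X) :\: Y; pose A := S :|: nbh G Y.
have sZL : Z \subset L by rewrite !subDset; apply: subset_trans sTL _; rewrite setUA subsetUr.
have deg3 : {in Z, forall l, deg G l <= 3} by move=> l /(subsetP sZL) /degL ->.
have [|nb2 sel2 d2] := selection_exists sZL (A := A) deg3.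
  (* A violator inside [Z] is disjoint from [Y], and its union with [Y] would be a larger
     violator. *)
  move=> Z' sZ'; rewrite leqNgt; apply/negP=> ltZ'.
  have dYZ' : [disjoint Y & Z'].
    by rewrite disjoint_sym disjoints_subset (subset_trans sZ') // /Z setDE subsetIr.
  suff /setUidPl Z'Y : Y :|: Z' = Y.
    by move: ltZ'; rewrite (_ : Z' = set0) ?cards0 ?muln0 //; move: dYZ';
       rewrite -setI_eq0 => /eqP; rewrite setIC (setIidPl Z'Y).
  apply: Ymax; last exact: subsetUl.
  rewrite /viol subUset sY (subset_trans sZ') ?subsetDl //= nbhU cardsU.
  rewrite (disjoint_setI0 dYZ') cards0 subn0.
  rewrite (_ : (nbh G Y :|: nbh G Z') :\: S = (nbh G Y :\: S) :|: (nbh G Z' :\: A)).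
    rewrite mulnDr (leq_trans _ (leq_add vY (ltnW ltZ'))) //.
    by rewrite -mulnDr leq_mul2l cardsU leq_subr.
  by apply/setP=> y; rewrite !inE; case: (y \in S); case: [exists x in Y, _].
(* [X1] may exceed [X :|: Y]. Only the edges at [X :|: Y] are kept from it: their right ends lie in
   [A], which [nb2] avoids. *)
pose nb' l := if l \in Z then nb2 l else nb1 l.
have nb'2 : {in Z, nb2 =1 nb'} by move=> l lZ; rewrite /nb' lZ.
have nb'1 : {in X :|: Y, nb1 =1 nb'}.
  move=> l lXY; rewrite /nb' ifN // !inE; move: lXY; rewrite inE.
  by case: (l \in X); case: (l \in Y).
have sXY : X :|: Y \subset X1 by rewrite subUset sX1.
have nb1A l : l \in X :|: Y -> nb1 l \subset A.
  case/setUP=> lM; first by rewrite e1 // subsetU // nbS.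
  apply: subsetU; apply/orP; right; apply: subset_trans (sub_nbh lM).
  by case: sel1 => _ sN _ _; apply: sN; apply: (subsetP sYX1).
exists (X :|: Y :|: Z), nb'; split.
- apply: union_selection.
  + exact: eq_selection nb'1 (sub_selection sel1 sXY).
  + exact: eq_selection nb'2 sel2.
  move=> x z xXY zZ; rewrite -nb'1 // -nb'2 // disjoint_sym.
  exact: disjointWr (nb1A _ xXY) (d2 _ zZ).
- split=> //; first by rewrite -setUA subsetUl.
    by move=> l lX; rewrite -nb'1 ?e1 // inE lX.
  move=> l; rewrite inE => /andP[lX /setUP[lXY|lZ]].
    by rewrite -nb'1 // d1 // inE lX (subsetP sXY).
  by rewrite -nb'2 //; apply: disjointWr (d2 _ lZ); apply: subsetUl.
by apply/subsetP=> x xT; rewrite !inE xT; case: (x \in X); case: (x \in Y).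
Qed.

Lemma card_bigcup_le (I : finType) (B : {set I}) (F : I -> {set V}) k m :
  #|B| <= k -> {in B, forall i, #|F i| <= m} -> #|\bigcup_(i in B) F i| <= k * m.
Proof.
move=> Bk Fm; apply: leq_trans (_ : #|B| * m <= _); last by rewrite leq_mul2r Bk orbT.
rewrite -sum_nat_const; apply: leq_trans (_ : \sum_(i in B) #|F i| <= _); last exact: leq_sum.
elim/big_ind2: _ => [|A1 n1 A2 n2 le1 le2|//]; first by rewrite cards0.
by rewrite (leq_trans (leq_card_setU _ _)) // leq_add.
Qed.

(* [l] is the other left vertex of the component of [v], or [v] itself. *)
Lemma component_of X nb v : selection X nb -> v \in X ->
  exists a r l b, [/\ l \in X, nb v = [set a; r], nb l = [set r; b] &
    {in X, forall x, x != v -> x != l -> [disjoint nb x & nb v :|: nb l]}].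
Proof.
move=> [_ _ c2 share] vX; have /eqP/cards2P[a [r [ar nbv]]] := c2 _ vX.
have disj Y Z : ~ (exists y, y \in Y :&: Z) -> [disjoint Y & Z].
  rewrite -setI_eq0 => H; apply/eqP/setP=> y; rewrite in_set0.
  by apply/negP=> yI; apply: H; exists y.
have [[l [lX lv [r0 r0I]]]|none] :=
    pselect (exists l, [/\ l \in X, l != v & exists r0, r0 \in nb v :&: nb l]); last first.
  exists a, r, v, a; split=> //; first by rewrite setUC.
  by move=> x xX xv _; rewrite setUid disjoint_sym; apply: disj => ex; apply: none; exists x.
have [r0v r0l] := setIP r0I.
have setI_in y Y Z : y \in Y -> y \in Z -> y \in Y :&: Z by rewrite inE => -> ->.
have other y : y \in X -> r0 \in nb y -> exists b, nb y = [set r0; b].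
  move=> yX r0y; have := c2 _ yX; rewrite (cardsD1 r0) r0y => -[/eqP/cards1P[b yb]].
  by exists b; rewrite -(setD1K r0y) yb.
have [a0 va0] := other _ vX r0v; have [b lb] := other _ lX r0l.
exists a0, r0, l, b; split=> // [|x xX xv xl]; first by rewrite setUC.
apply: disj => -[y].
case/setIP=> yx /setUP[yv|yl]; move: xl.
  have [-> _] := share _ _ _ vX xX lX y r0 xv lv (setI_in _ _ _ yv yx) (setI_in _ _ _ r0v r0l).
  by rewrite eqxx.
rewrite eq_sym in lv => xl.
have [xv' _] := share _ _ _ lX xX vX y r0 xl lv (setI_in _ _ _ yl yx) (setI_in _ _ _ r0l r0v).
by rewrite xv' eqxx in xv.
Qed.

(** * Covering a challenged vertex *)

Variable d : nat.
Hypothesis G_sym : symmetric G.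
Hypothesis degR : {in R, forall y, deg G y <= d}.

Lemma neighbourL x y : x \in L -> G x y -> y \in R.
Proof.
case: G_bip => _ /disjoint_setI0 LR biG xL /biG[[]//|[xR _]].
suff : x \in L :&: R by rewrite LR inE.
by rewrite inE xL.
Qed.

Lemma neighbourR x y : x \in R -> G x y -> y \in L.
Proof.
case: G_bip => _ /disjoint_setI0 LR biG xR /biG[[xL _]|[]//].
suff : x \in L :&: R by rewrite LR inE.
by rewrite inE xL.
Qed.

(* If each of the at most [27 * d] candidate components for [v] were
   obstructed, the union of their small obstructions would, together with [v],
   obstruct the current position. *)
Lemma safe_add_left X nb S v :
  safe X nb S -> v \in L -> 189 * d * (#|S| + 3) + 1 <= s ->
  exists X' nb' S', [/\ safe X' nb' S', extends X nb S X' nb' S', v \in X' &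
                        #|S'| <= #|S| + 3].
Proof.
move=> [lgl ext] vL bound; have [vX|vX] := boolP (v \in X).
  by exists X, nb, S; split; rewrite ?leq_addr //; apply: extends_refl.
apply: contrapT => noext; have [_ nbS SR] := lgl.
(* A candidate [c = (a, r, l, b)] stands for the path a - v - r - l - b, or for a - v - r when
   [l = v] and [b = a]. *)
pose Xc l := X :|: [set v; l].
pose nbc (c : V * V * V * V) x :=
  if x == v then [set c.1.1.1; c.1.1.2] else if x == c.1.2 then [set c.1.1.2; c.2] else nb x.
pose Sc (c : V * V * V * V) := S :|: [set c.1.1.1; c.1.1.2; c.2].
(* If there were no such [T], the case of the empty set would make the candidate a legal extension,
   and [small_obstruction] would make it safe, contrary to [noext]. *)
have obstr c : exists T, [/\ T \subset L, #|T| <= 7 * (#|S| + 3) &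
    legal (Xc c.1.2) (nbc c) (Sc c) -> extends X nb S (Xc c.1.2) (nbc c) (Sc c) ->
    ~ extendable (Xc c.1.2) (nbc c) (Sc c) T].
  apply: contrapT => /forallNP noT.
  have [lglc extc] : legal (Xc c.1.2) (nbc c) (Sc c) /\
      extends X nb S (Xc c.1.2) (nbc c) (Sc c).
    apply: contrapT => nl; apply: (noT set0); split; rewrite ?sub0set ?cards0 //.
    by move=> l1 l2 _; apply: nl.
  have leS : #|Sc c| <= #|S| + 3.
    apply: leq_trans (leq_card_setU _ _) _; rewrite leq_add2l.
    apply: leq_trans (leq_card_setU _ _) _; rewrite cards1 cards2; by case: (_ != _).
  apply: noext; exists (Xc c.1.2), (nbc c), (Sc c); split=> //; last by rewrite !inE eqxx orbT.
  split=> // T sTL cT; apply: small_obstruction => // T' sT' cT'.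
  apply: contrapT => next; apply: (noT T'); split=> //; first exact: subset_trans sTL.
  by apply: leq_trans cT' _; rewrite leq_mul2l.
have [Tc TcP] := choice obstr.
pose U := \bigcup_(a in N v) \bigcup_(r in N v) \bigcup_(l in N r)
  \bigcup_(b in N l) Tc (a, r, l, b).
(* The factors count the choices of [a], [r], [l] and [b]: 3 * 3 * d * 3 = 27 d, and 7 * 27 =
   189. *)
have cU : #|U| <= 3 * (3 * (d * (3 * (7 * (#|S| + 3))))).
  have cv : #|N v| <= 3 by rewrite -[#|_|]/(deg G v) degL.
  apply: card_bigcup_le => // a _; apply: card_bigcup_le => // r; rewrite inE => vr.
  have rR := neighbourL vL vr; apply: card_bigcup_le; first exact: degR.
  move=> l; rewrite inE => /(neighbourR rR) lL; apply: card_bigcup_le.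
    by rewrite -[#|_|]/(deg G l) degL.
  by move=> b _; case: (TcP (a, r, l, b)).
(* The summand 1 in the bound makes room for [v] itself. *)
have [||X1 [nb1 [sel1 [sX1 _ e1 d1] sT1]]] := ext (v |: U).
- rewrite subUset sub1set vL; apply/bigcupsP=> a _; apply/bigcupsP=> r _.
  by apply/bigcupsP=> l _; apply/bigcupsP=> b _; case: (TcP (a, r, l, b)).
- apply: leq_trans bound; apply: leq_trans (leq_card_setU _ _) _; rewrite cards1.
  move: cU; lia.
have vX1 : v \in X1 by apply: (subsetP sT1); rewrite setU11.
have [a [r [l [b [lX1 nbv nbl dis]]]]] := component_of sel1 vX1.
have [sX1L sN1 _ _] := sel1.
have lL := subsetP sX1L _ lX1.
have av : a \in N v by apply: (subsetP (sN1 _ vX1)); rewrite nbv set21.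
have rv : r \in N v by apply: (subsetP (sN1 _ vX1)); rewrite nbv set22.
have rl : r \in N l by apply: (subsetP (sN1 _ lX1)); rewrite nbl set21.
have bl : b \in N l by apply: (subsetP (sN1 _ lX1)); rewrite nbl set22.
have lX : l \notin X.
  apply/negP=> lX; have rS : r \in S by apply: (subsetP (nbS _ lX)); rewrite -e1 // nbl set21.
  have dv : [disjoint nb1 v & S] by apply: d1; rewrite inE vX.
  by rewrite (disjointFr dv) // nbv set22 in rS.
pose c := (a, r, l, b).
have e1c : {in Xc l, nb1 =1 nbc c}.
  move=> x; rewrite /nbc !inE /=; have [->|xv] := eqVneq x v; first by rewrite nbv.
  have [->|xl] := eqVneq x l; first by rewrite nbl.
  by rewrite !orbF; apply: e1.
have sXc : Xc l \subset X1.
  by rewrite subUset sX1; apply/subsetP=> x /set2P[] ->.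
(* The component of [v] under [nb1] is the candidate [c], and [X1] with [nb1] covers [Tc c] while
   extending that candidate, contrary to the choice of [Tc c]. *)
have [_ _] := TcP c.
rewrite -[c.1.2]/l; apply.
- split.
  + exact: eq_selection e1c (sub_selection sel1 sXc).
  + move=> x xXc; rewrite -e1c //; case/setUP: xXc => [xX|/set2P[]->].
    * by rewrite e1 // subsetU // nbS.
    * by rewrite nbv; apply/subsetP=> y /set2P[] ->; rewrite !inE eqxx ?orbT.
    * by rewrite nbl; apply/subsetP=> y /set2P[] ->; rewrite !inE eqxx ?orbT.
  rewrite subUset SR; apply/subsetP=> y; rewrite -setUA !inE => /or3P[] /eqP->.
  + by move: av; rewrite inE; apply: neighbourL.
  + by move: rv; rewrite inE; apply: neighbourL.
  + by move: bl; rewrite inE; apply: neighbourL.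
- split; rewrite ?subsetUl // => x xX.
    by rewrite -e1c ?e1 // inE xX.
  have /setDP[xXc xX'] := xX; rewrite -e1c // d1 // inE xX'.
  exact: (subsetP sXc).
exists X1, nb1; split=> //.
- split=> // x /setDP[xX1]; rewrite !inE !negb_or => /and3P[xX xv xl].
  have := dis _ xX1 xv xl; have := d1 x; rewrite inE xX => /(_ xX1).
  rewrite ![[disjoint nb1 x & _]]disjoint_sym !disjoints_subset => dS dv.
  rewrite subUset dS; apply: subset_trans dv; rewrite nbv nbl.
  by apply/subsetP=> y; rewrite !inE => /orP[/orP[]|] ->; rewrite ?orbT.
apply: subset_trans sT1; apply: subset_trans (subsetUr _ _).
apply: subset_trans (bigcup_sup a av).
apply: subset_trans (bigcup_sup r rv).
have lr : l \in N r by rewrite inE G_sym; rewrite inE in rl.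
apply: subset_trans (bigcup_sup l lr).
exact: (@bigcup_sup _ _ b (mem (N l)) (fun b => Tc (a, r, l, b)) bl).
Qed.

(** Each addition brings at most 3 right vertices, so the bound for the final size serves at every
    step. The guard on [size zs] accommodates the empty list, as for a right vertex without
    neighbours. *)
Lemma safe_add_lefts (zs : seq V) X nb S :
  safe X nb S -> {subset zs <= L} ->
  (0 < size zs -> 189 * d * (#|S| + 3 * size zs) + 1 <= s) ->
  exists X' nb' S', [/\ safe X' nb' S', extends X nb S X' nb' S', {subset zs <= X'} &
                        #|S'| <= #|S| + 3 * size zs].
Proof.
elim: zs X nb S => [|z zs IH] X nb S sf zL bound.
  by exists X, nb, S; split; rewrite ?leq_addr //; apply: extends_refl.
have [||X1 [nb1 [S1 [sf1 ext1 zX1 c1]]]] := @safe_add_left X nb S z sf.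
- by apply: zL; rewrite mem_head.
- apply: leq_trans (bound isT).
  by rewrite leq_add2r leq_mul2l /= leq_add2l mulnS leq_addr orbT.
have [||X2 [nb2 [S2 [sf2 ext2 zX2 c2]]]] := IH _ _ _ sf1.
- by move=> x xz; apply: zL; rewrite inE xz orbT.
- move=> _; apply: leq_trans (bound isT).
  by rewrite leq_add2r leq_mul2l /= mulnS addnA leq_add2r c1 orbT.
exists X2, nb2, S2; split=> //; first exact: extends_trans ext2.
  move=> x; rewrite inE => /orP[/eqP->|/zX2//].
  by case: ext2 => /subsetP s2 _ _ _; apply: s2.
by move: c1 c2 => /=; lia.
Qed.

(* Once every neighbour of [v] is covered, no later component can use [v]. *)
Lemma safe_add_right X nb S v :
  safe X nb S -> v \in R -> (0 < d -> 189 * d * (#|S| + 3 * d) + 1 <= s) ->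
  exists X' nb' S', [/\ safe X' nb' S', extends X nb S X' nb' S' & v \in S'].
Proof.
move=> sf vR bound; have cN : size (enum (N v)) <= d by rewrite -cardE; apply: degR.
have [||X1 [nb1 [S1 [[[sel1 nbS1 SR1] ext1] ex1 sN _]]]] :=
    @safe_add_lefts (enum (N v)) X nb S sf.
- by move=> x; rewrite mem_enum inE; apply: neighbourR.
- move=> N0; apply: leq_trans (bound (leq_trans N0 cN)).
  by rewrite leq_add2r leq_mul2l leq_add2l leq_mul2l cN !orbT.
exists X1, nb1, (v |: S1); split; last exact: setU11.
- split.
    split=> //; first by move=> l lX; rewrite subsetU // nbS1 ?orbT.
    by rewrite subUset sub1set vR.
  move=> T sTL cT; have [X2 [nb2 [sel2 [sX2 _ e2 d2] sT2]]] := ext1 T sTL cT.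
  exists X2, nb2; split=> //; split=> // l lX; have /setDP[lX2 lX1] := lX.
  rewrite disjoint_sym disjoints_subset subUset sub1set inE -disjoints_subset.
  rewrite disjoint_sym d2 // andbT; apply: contra lX1 => vl; apply: sN.
  rewrite mem_enum inE G_sym; have [_ sN2 _ _] := sel2.
  by have := subsetP (sN2 _ lX2) _ vl; rewrite inE.
apply: extends_trans ex1 _; split=> //; first exact: subsetUr.
by move=> l; rewrite setDv inE.
Qed.

(** * The matching of a position *)

Definition pos X nb S : sub V :=
  (X :|: S, \bigcup_(l in X) [set [set l; r] | r in nb l]).

Lemma edge_posP X nb S a :
  reflect (exists l r, [/\ l \in X, r \in nb l & a = [set l; r]]) (a \in edges (pos X nb S)).
Proof.
apply: (iffP bigcupP) => [[l lX /imsetP[r rl ->]]|[l [r [lX rl ->]]]].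
  by exists l, r.
by exists l => //; apply: imset_f.
Qed.

Lemma notinLR x : x \in L -> x \in R -> False.
Proof.
case: G_bip => _ /disjoint_setI0 LR _ xL xR; suff : x \in L :&: R by rewrite LR inE.
by rewrite inE xL.
Qed.

Section Positions.
Variables (X S : {set V}) (nb : V -> {set V}).
Hypothesis lgl : legal X nb S.

Lemma legalL x : x \in X -> x \in L.
Proof. by case: lgl => -[/subsetP s' _ _ _] _ _; apply: s'. Qed.

Lemma legalS l r : l \in X -> r \in nb l -> r \in S.
Proof. by case: lgl => _ nbS _ /nbS /subsetP; apply. Qed.

Lemma legalR r : r \in S -> r \in R.
Proof. by case: lgl => _ _ /subsetP; apply. Qed.

Lemma legal_neq l r : l \in X -> r \in S -> l != r.
Proof.
move=> lX; apply: contraTneq => <-; apply/negP=> lS.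
exact: notinLR (legalL lX) (legalR lS).
Qed.

Lemma adj_pos x y :
  adj (pos X nb S) x y = (x \in X) && (y \in nb x) || (y \in X) && (x \in nb y).
Proof.
apply/idP/idP => [/andP[xy /edge_posP[l [r [lX rl e]]]]|].
  by case: (set2_inj xy e) => -[-> ->]; rewrite lX rl ?orbT.
have adjLR l r : l \in X -> r \in nb l -> adj (pos X nb S) l r.
  move=> lX rl; apply/andP; split; first exact: legal_neq lX (legalS lX rl).
  by apply/edge_posP; exists l, r.
by case/orP=> /andP[]; [|rewrite adj_sym]; apply: adjLR.
Qed.

Lemma subgraph_pos : is_subgraph G (pos X nb S).
Proof.
move=> _ /edge_posP[l [r [lX rl ->]]]; exists l, r; split=> //.
- by rewrite inE lX.
- by rewrite inE (legalS lX rl) orbT.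
by case: lgl => -[_ sN _ _] _ _; have := subsetP (sN _ lX) _ rl; rewrite inE.
Qed.

Lemma adj_posL l r : l \in X -> adj (pos X nb S) l r = (r \in nb l).
Proof.
move=> lX; rewrite adj_pos lX /=; have [//|_ /=] := boolP (r \in nb l).
by apply/andP=> -[rX lr]; apply: notinLR (legalL lX) (legalR (legalS rX lr)).
Qed.

Lemma adj_posR l r : r \in S -> adj (pos X nb S) r l = (l \in X) && (r \in nb l).
Proof.
move=> rS; rewrite adj_pos (_ : (r \in X) = false) //.
by apply/negP=> /legalL rL; apply: notinLR rL (legalR rS).
Qed.

(* A cycle would leave some left vertex through two right vertices that are
   both shared with other left vertices. *)
Lemma acyclic_pos : acyclic_sub (pos X nb S).
Proof.
move=> c c2 /andP[cc uc].
have [l lX lc] : exists2 l, l \in X & l \in c.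
  case: c c2 cc {uc} => // x c _ cc; have xc : x \in x :: c by rewrite mem_head.
  have := next_cycle cc xc; rewrite adj_pos => /orP[] /andP[lX _].
    by exists x.
  by exists (next (x :: c) x); rewrite ?mem_next.
have r1l := next_cycle cc lc; rewrite adj_posL // in r1l.
have r1S := legalS lX r1l.
have := prev_cycle cc lc; rewrite adj_sym adj_posL // => r2l; have r2S := legalS lX r2l.
have := next_cycle cc (x := next c l); rewrite mem_next => /(_ lc).
rewrite adj_posR // => /andP[l1X r1l1].
have := prev_cycle cc (x := prev c l); rewrite mem_prev => /(_ lc).
rewrite adj_sym adj_posR // => /andP[l2X r2l2].
have l1l := next_next_neq uc c2 lc.
have l2l : prev c (prev c l) != l.
  have := next_next_neq uc c2 (x := prev c (prev c l)); rewrite !mem_prev => /(_ lc).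
  by rewrite !next_prev // eq_sym.
case: lgl => -[_ _ _ share] _ _.
have [||_ e] := share _ _ _ lX l1X l2X (next c l) (prev c l) l1l l2l.
- by rewrite inE r1l.
- by rewrite inE r2l.
by rewrite e next_prev // eqxx in l1l.
Qed.

(** A component with a left vertex [l] stays within [l], its partner [l'] and their at most three
    right vertices, as no other left vertex is joined to these; a component without one is an
    isolated right vertex. *)
Lemma component_small x : x \in verts (pos X nb S) ->
  #|verts (component (pos X nb S) x) :&: S| <= 3 /\
  #|edges (component (pos X nb S) x)| <= 4.
Proof.
set F := pos X nb S => xF; have sub_F := subgraph_pos; have symF := sym_connect_sym (adj_sym F).
have [[l [lX xl]]|none] := pselect (exists l, l \in X /\ connect (adj F) x l).
  case: lgl => sel _ _; have [a [r [l' [b [l'X nbl nbl' dis]]]]] := component_of sel lX.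
  have ar y : y \in nb l -> y \in [set a; r; b] by rewrite nbl !inE => /orP[] ->; rewrite ?orbT.
  have rb y : y \in nb l' -> y \in [set a; r; b] by rewrite nbl' !inE => /orP[] ->; rewrite ?orbT.
  have arb y : y \in [set a; r; b] -> (y \in nb l) || (y \in nb l').
    by rewrite nbl nbl' !inE => /orP[/orP[]|] ->; rewrite ?orbT.
  have SD y : y \in [set a; r; b] -> y \in S by case/arb/orP; apply: legalS.
  pose D := [set l; l'] :|: [set a; r; b].
  have DX y : y \in X -> y \in D -> y \in [set l; l'].
    by move=> yX /setUP[//|/SD/legalR /(notinLR (legalL yX))].
  have sCD y : y \in verts (component F x) -> y \in D.
    rewrite inE => /andP[_]; rewrite (same_connect symF xl).
    have lD : l \in D by rewrite !inE eqxx.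
    case/(connect_closed _ lD) => // {}y z yD; rewrite adj_pos => /orP[] /andP[uX wu].
      by apply/setUP; right; case/set2P: (DX _ uX yD) wu => ->; [apply: ar | apply: rb].
    have yarb : y \in [set a; r; b].
      case/setUP: yD => // /set2P[] ey; case: (@notinLR y); rewrite ?(legalR (legalS uX wu)) //;
        by rewrite ey legalL.
    apply/setUP; left; apply: contraT; rewrite !inE negb_or => /andP[zl zl'].
    have := disjointFr (dis _ uX zl zl') wu; rewrite inE.
    by rewrite arb.
  split.
    apply: leq_trans (_ : #|[set a; r; b]| <= 3).
      apply/subset_leq_card/subsetP=> y /setIP[/sCD /setUP[|//] yl yS].
      by case: (@notinLR y); [case/set2P: yl => ->; apply: legalL | apply: legalR].
    by apply: leq_trans (leq_card_setU _ _) _; rewrite cards1 cards2; case: (_ != _).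
  have card2 z : #|[set [set z; y] | y in nb z]| <= #|nb z| by apply: leq_imset_card.
  apply: leq_trans (_ :
    #|[set [set l; y] | y in nb l] :|: [set [set l'; y] | y in nb l']| <= _).
    apply/subset_leq_card/subsetP=> e; rewrite inE => /andP[/edge_posP[z [y [zX yz ->]]]].
    rewrite subUset !sub1set => /andP[/sCD/(DX _ zX) zl _].
    by case/set2P: zl yz => -> yz; apply/setUP;
      first [by left; apply: imset_f | by right; apply: imset_f].
  apply: leq_trans (leq_card_setU _ _) _; case: sel => _ _ c2 _.
  by rewrite -[4]/(2 + 2) leq_add // (leq_trans (card2 _)) // c2.
have xX : x \notin X by apply/negP=> xX; apply: none; exists x; rewrite connect0.
have sC y : y \in verts (component F x) -> y = x.
  rewrite inE => /andP[_]; have xD : x \in [set x] by rewrite inE.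
  case/(connect_closed _ xD) => [u v /set1P-> xv|_ /set1P//].
  case: none; have := xv; rewrite adj_pos (negPf xX) /= => /andP[vX _].
  by exists v; rewrite connect1.
split.
  apply: leq_trans (_ : #|[set x]| <= _); last by rewrite cards1.
  by apply/subset_leq_card/subsetP=> y /setIP[/sC -> _]; rewrite inE.
rewrite (_ : edges _ = set0) ?cards0 //; apply/setP=> e; rewrite in_set0.
apply/negP; rewrite inE => /andP[/edge_posP[z [y [zX yz ->]]]].
by rewrite subUset !sub1set => /andP[/sC zx _]; rewrite -zx zX in xX.
Qed.

Lemma matching24_pos : matching24 G L (pos X nb S).
Proof.
split; first exact: subgraph_pos.
  move=> C /imsetP[x xF ->]; split; last by case: (component_small xF).
  split; first exact: component_connected subgraph_pos xF.
  apply: acyclic_subset acyclic_pos; apply/subsetP=> e; by rewrite inE => /andP[].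
move=> x /setIP[/setUP[xX|/legalR xR] xL]; last by case: (notinLR xL xR).
case: lgl => -[_ _ c2 _] _ _; rewrite -(c2 x xX); apply: eq_card => y.
by rewrite inE adj_posL.
Qed.

(** This turns the limit on components at a challenge into a limit on [S], which governs the size of
    obstructions. *)
Lemma card_right_components : #|S| <= #|components (pos X nb S)| * 3.
Proof.
set F := pos X nb S.
apply: leq_trans (_ : #|\bigcup_(C in components F) (verts C :&: S)| <= _).
  apply/subset_leq_card/subsetP=> r rS; have rF : r \in verts F by rewrite inE rS orbT.
  apply/bigcupP; exists (component F r); first exact: imset_f.
  by apply/setIP; split=> //; apply: component_refl.
by apply: card_bigcup_le => // C /imsetP[x xF ->]; case: (component_small xF).
Qed.

Lemma component_L_closed x l r (D := verts (component (pos X nb S) x)) :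
  l \in X -> r \in nb l -> (l \in D) = (r \in D).
Proof.
by move=> lX rl; apply: component_closed subgraph_pos _; rewrite adj_posL.
Qed.

Lemma remove_pos x (D := verts (component (pos X nb S) x)) :
  remove_component (pos X nb S) (component (pos X nb S) x) = pos (X :\: D) nb (S :\: D).
Proof.
congr (_, _); first by rewrite setDUl.
apply/setP=> e; rewrite in_setD inE; apply/andP/(edge_posP _ _ (S :\: D)).
  case=> + eF; rewrite eF /=; case/edge_posP: eF => l [r [lX rl ->]] nD.
  exists l, r; split=> //; rewrite inE lX andbT; apply: contra nD => lD.
  by rewrite subUset !sub1set; apply/andP; split=> //; rewrite -(component_L_closed x lX rl).
case=> l [r [/setDP[lX lD] rl ->]].
have eF : [set l; r] \in edges (pos X nb S) by apply/edge_posP; exists l, r.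
by rewrite eF subUset !sub1set /= (negPf lD).
Qed.

End Positions.

(** No new left vertex touches [S], so old vertices have the same neighbours in both positions, and
    with them the same components. *)
Lemma components_extends X nb S X' nb' S' :
  legal X nb S -> legal X' nb' S' -> extends X nb S X' nb' S' ->
  components (pos X nb S) \subset components (pos X' nb' S').
Proof.
move=> lgl lgl' [/subsetP sX /subsetP sS e dis]; set F := pos X nb S; set F' := pos X' nb' S'.
have adjF x y : x \in verts F -> adj F' x y = adj F x y.
  move=> /setUP[xX|xS].
    by rewrite (adj_posL lgl') ?(adj_posL lgl) ?sX // e.
  rewrite (adj_posR lgl') ?(adj_posR lgl) ?sS //.
  have [yX|yX] /= := boolP (y \in X); first by rewrite sX ?e.
  apply/andP=> -[yX' xy]; have := dis y; rewrite inE yX => /(_ yX') dy.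
  by rewrite (disjointFr dy xy) in xS.
have FF' x : x \in verts F -> x \in verts F'.
  by case/setUP=> [/sX|/sS] xM; rewrite inE xM ?orbT.
have conn x y : x \in verts F -> connect (adj F') x y = connect (adj F) x y && (y \in verts F).
  move=> xF; apply/idP/andP=> [|[+ _]].
    have cl u v : u \in verts F -> adj F' u v -> v \in verts F.
      by move=> uF; rewrite adjF // => /(adj_verts (subgraph_pos lgl))[].
    case/(connect_closed cl xF)=> xy yF; split=> //; apply: connect_sub xy => u v.
    by move=> /and3P[uF _ uv]; rewrite connect1 // -adjF.
  have cl u v : u \in verts F -> adj F u v -> v \in verts F.
    by move=> _ /(adj_verts (subgraph_pos lgl))[].
  case/(connect_closed cl xF)=> + _; apply: connect_sub => u v.
  by move=> /and3P[uF _ uv]; rewrite connect1 // adjF.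
apply/subsetP=> _ /imsetP[x xF ->]; apply/imsetP; exists x; first exact: FF'.
have eV : verts (component F' x) = verts (component F x).
  apply/setP=> y; rewrite [LHS]inE [RHS]inE conn // andbC.
  by case: (boolP (y \in verts F)) => [/FF'->|_]; rewrite ?andbT ?andbF.
congr (_, _); first exact/esym.
apply/setP=> e0.
have edgesC F0 : (e0 \in edges (component F0 x)) =
    (e0 \in edges F0) && (e0 \subset verts (component F0 x)) by rewrite inE.
rewrite [LHS]edgesC [RHS]edgesC eV.
case sC: (e0 \subset _); rewrite ?andbF // !andbT.
apply/(edge_posP _ _ S')/(edge_posP _ _ S)=> -[l [r [lX rl ee]]]; exists l, r.
  by split; rewrite ?sX ?e.
(* The left end [l] lies in an old component; being in [L], it is not in [S], so it belongs to
   [X]. *)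
suff lX0 : l \in X by split; rewrite // -e.
have : l \in verts (component F x) by apply: (subsetP sC); rewrite ee set21.
rewrite inE => /andP[/setUP[//|lS] _].
by case: (notinLR (legalL lgl' lX) (legalR lgl lS)).
Qed.

(** * Safety along the moves of the game *)

(** With [S] empty, small obstructions have at most 7 * 0 elements, so only the empty set has to be
    covered by hand. *)
Lemma safe_start nb : safe set0 nb set0.
Proof.
have lgl : legal set0 nb set0.
  split=> [|l|]; rewrite ?sub0set ?inE //.
  by split=> [|l|l|l l1 l2]; rewrite ?sub0set ?inE.
split=> // T sTL cT; apply: small_obstruction => // T' _.
rewrite cards0 leqn0 cards_eq0 => /eqP->; exists set0, nb; split=> //.
- by case: lgl.
by split=> // l; rewrite setDv inE.
Qed.

(** Extensions of the old position also extend the new one: removed left vertices may return with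
    their old edges, whose right ends lie in the removed component and so miss [S :\: D]. *)
Lemma safe_remove X nb S C : safe X nb S -> C \in components (pos X nb S) ->
  exists X' S', remove_component (pos X nb S) C = pos X' nb S' /\ safe X' nb S'.
Proof.
move=> [lgl ext] /imsetP[x xF ->]; rewrite (remove_pos lgl).
have Dcl := component_L_closed lgl x; set D := verts _ in Dcl *.
exists (X :\: D), (S :\: D); split=> //; split.
  have [sel nbS SR] := lgl; split.
  - by apply: sub_selection sel _; apply: subsetDl.
  - move=> l /setDP[lX lD]; apply/subsetP=> r rl; rewrite inE (legalS lgl lX rl) andbT.
    by rewrite -(Dcl _ _ lX rl).
  by apply: subset_trans SR; apply: subsetDl.
move=> T sTL cT; have [X1 [nb1 [sel1 [sX _ e d1] sT]]] := ext T sTL cT.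
exists X1, nb1; split=> //; split=> //.
- by apply: subset_trans sX; apply: subsetDl.
- by move=> l /setDP[lX _]; apply: e.
move=> l /setDP[lX1]; rewrite inE negb_and negbK.
have [lX|lX] := boolP (l \in X); rewrite ?orbF ?orbT /= => lD; last first.
  by apply: disjointWr (subsetDl _ _) _; apply: d1; rewrite inE lX.
rewrite e // disjoint_sym disjoints_subset; apply/subsetP=> r /setDP[_ rD].
by rewrite inE; apply: contra rD => rl; rewrite -(Dcl _ _ lX rl).
Qed.

Lemma safe_answer X nb S v :
  safe X nb S ->
  (0 < d -> 567 * d * (#|components (pos X nb S)| + d) + 1 <= s) ->
  exists X' nb' S', [/\ safe X' nb' S', v \in verts (pos X' nb' S'),
    matching24 G L (pos X' nb' S') &
    components (pos X nb S) \subset components (pos X' nb' S')].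
Proof.
move=> sf bound; have [lgl _] := sf; have cS := card_right_components lgl.
suff [X' [nb' [S' [sf' ex vF]]]] : exists X' nb' S',
    [/\ safe X' nb' S', extends X nb S X' nb' S' & v \in verts (pos X' nb' S')].
  exists X', nb', S'; have [lgl' _] := sf'; split=> //; first exact: matching24_pos.
  exact: components_extends.
(* Each component has at most 3 right vertices, whence 567 = 3 * 189. *)
have bound' : 0 < d -> 189 * d * (#|S| + 3 * d) + 1 <= s.
  move=> d0; apply: leq_trans (bound d0); rewrite leq_add2r -[567]/(189 * 3).
  by rewrite -!mulnA leq_mul2l /= [leqRHS]mulnCA leq_mul2l mulnDr leq_add2r mulnC cS orbT.
have : v \in L :|: R by case: G_bip => -> _ _; rewrite inE.
case/setUP=> vV; last first.
  have [X' [nb' [S' [sf' ex vS]]]] := safe_add_right sf vV bound'.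
  by exists X', nb', S'; split=> //; rewrite inE vS orbT.
(* A left vertex has degree 3, so some right vertex has positive degree. *)
have d0 : 0 < d.
  have /set0Pn[r] : [set y | G v y] != set0.
    by rewrite -card_gt0 -[#|_|]/(deg G v) degL.
  rewrite inE => vr; apply: leq_trans (degR (neighbourL vV vr)).
  by rewrite card_gt0; apply/set0Pn; exists v; rewrite inE G_sym.
have [|X' [nb' [S' [sf' ex vX _]]]] := safe_add_left sf vV.
  by apply: leq_trans (bound' d0); rewrite leq_add2r leq_mul2l leq_add2l leq_pmulr ?orbT.
by exists X', nb', S'; split=> //; rewrite inE vX.
Qed.

End Selections.

(** * The game *)

(** Coverer answers from the current position and the challenge alone; the invariant holds along
    every consistent history by induction. *)
Lemma safe_strategy (V : finType) (G : rel V) (L : {set V}) (K : realType) (mu : K)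
    (inv : sub V -> Prop) :
  inv (empty_sub V) ->
  (forall F C, inv F -> C \in components F -> inv (remove_component F C)) ->
  (forall F v, inv F -> may_challenge mu F -> exists F', answers G L F v F' /\ inv F') ->
  coverer_wins G L mu.
Proof.
move=> inv0 invR invA.
have /choice[next nextP] (p : sub V * V) : exists F', inv p.1 -> may_challenge mu p.1 ->
    answers G L p.1 p.2 F' /\ inv F'.
  case: p => F v /=; have [iF|nF] := pselect (inv F); last by exists F.
  have [cF|ncF] := pselect (may_challenge mu F); last by exists F.
  by have [F' F'P] := invA F v iF cF; exists F'.
pose sigma h v := next (position h, v).
have inv_pos h : consistent mu sigma h -> inv (position h).
  elim=> {h} [//|h C _ iF Cc|h v _ iF cF] /=; first exact: invR.
  by case: (nextP (position h, v) iF cF).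
exists sigma => h v ch cF.
by case: (nextP (position h, v) (inv_pos h ch) cF).
Qed.

(** * The numerical bound and the theorem *)

Local Open Scope ring_scope.

(** With u = c + d the hypothesis reads u (72 d + 2 eps) < eps s, and eps (567 d u + 1) is at most
    the left side, because 567 eps < 567/23 < 72 and 1 <= u. *)
Lemma challenge_bound (K : realType) (eps : K) (s : int) (d c : nat) :
  0 < eps -> eps < 1 / 23%:R -> (0 < d)%N ->
  c%:R < eps * s%:~R / (72%:R * d%:R + 2%:R * eps) - d%:R ->
  (567 * d * (c + d) + 1)%N%:Z <= s.
Proof.
move=> eps0 eps23 d0; rewrite ltrBrDr -natrD.
have d1 : 1 <= d%:R :> K by rewrite ler1n.
rewrite ltr_pdivlMr; last by nra.
move=> H; rewrite -(ler_int K) /=.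
have cd : 1 <= (c + d)%:R :> K by rewrite ler1n ltn_addl.
rewrite -pmulrn natrD !natrM -(ler_pM2l eps0); apply: ltW; apply: le_lt_trans H.
set u := (c + d)%:R in cd *; set D := d%:R in d1 *.
have D_u : 0 <= D * u by rewrite mulr_ge0 // ?(le_trans ler01).
have : 0 <= D * u * (1 - 23%:R * eps) by rewrite mulr_ge0 // subr_ge0; lra.
have : 0 <= eps * (u - 1) by rewrite mulr_ge0 ?subr_ge0 // ltW.
nra.
Qed.

Theorem theorem8 (K : realType) (V : finType) (G : rel V) (L R : {set V})
    (s d : int) (eps : K) :
  simple_graph G ->
  bipartition G L R ->
  0 < eps -> eps < 1 / 23%:R ->
  (forall x, x \in L -> deg G x = 3%N) ->
  (forall y, y \in R -> (deg G y)%:Z <= d) ->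
  expander G L s (2%:R - eps / 2%:R) ->
  coverer_wins G L
    (eps * s%:~R / (72%:R * d%:~R + 2%:R * eps) - d%:~R).
Proof.
move=> [symG _] bip eps0 eps23 degL degR expG.
(* A negative [s] becomes 0, which leaves only the empty set to expand. *)
pose sn : nat := if s is Posz n then n else 0%N.
have expands (X : {set V}) : X \subset L -> (#|X| <= sn)%N -> (91 * #|X| <= 46 * #|nbh G X|)%N.
  move=> sXL cX; have [->|X0] := eqVneq X set0; first by rewrite cards0.
  have /expG -/(_ sXL) : #|X|%:Z <= s.
    by move: cX; rewrite /sn; case: (s) => [//|n]; rewrite leqn0 cards_eq0 (negPf X0).
  move=> H; rewrite -(ler_nat K) !natrM.
  have := ler0n K #|X|; nra.
pose inv F := exists X nb S, F = pos X nb S /\ safe G L R sn X nb S.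
have degRN : {in R, forall y, deg G y <= if d is Posz n then n else 0}%N.
  by move=> y /degR; case: (d).
(* Any vertex forces [d] to be nonnegative: the degree of a right vertex is at most [d], and a left
   vertex has a neighbour in [R]. At a challenge [d] is thus a natural number. *)
have d_ge0 (v : V) : 0 <= d.
  have R_ge0 y : y \in R -> 0 <= d by move=> /degR; apply: le_trans.
  have : v \in L :|: R by case: (bip) => -> _ _; rewrite inE.
  case/setUP=> [vL|/R_ge0//]; have /set0Pn[r] : [set y | G v y] != set0.
    by rewrite -card_gt0 -[#|_|]/(deg G v) degL.
  by rewrite inE => /(neighbourL bip vL)/R_ge0.
apply: (@safe_strategy _ _ _ _ _ inv).
- exists set0, (fun _ => set0), set0; split; last exact: safe_start.
  by rewrite /pos setU0 big_set0.
- move=> _ C [X [nb [S [-> sf]]]] CF.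
  by have [X' [S' [-> sf']]] := safe_remove bip sf CF; exists X', nb, S'.
move=> _ v [X [nb [S [-> sf]]]] cF; have := d_ge0 v.
case: d degRN cF {d_ge0 degR} => // d degRN cF _.
have [|X' [nb' [S' [sf' vF mF cC]]]] := safe_answer bip degL expands symG degRN v sf.
  move=> d0; have := challenge_bound eps0 eps23 d0 cF.
  by rewrite /sn; case: (s).
by exists (pos X' nb' S'); split; [split | exists X', nb', S'].
Qed.
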